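(* A pressure equilibrium $p\equiv\mathrm{const}$, $v\equiv\mathrm{const}$ is preserved by any general linear method applied to the semi-discretization $$\partial_t u_i+\sum_{l}2D_{i,l}f^{\mathrm{num}}(u_i,u_l)=0$$ of the one-dimensional compressible Euler equations if the numerical flux $f^{\mathrm{num}}$ is PEP (pressure-equilibrium-preserving).
   Context: The 1D compressible Euler equations are $\partial_t u+\partial_x f(u)=0$ with $u=(\rho,\rho v,\rho e)$, $f(u)=(\rho v,\rho v^2+p,(\rho e+p)v)$ and the ideal gas law $p=(\gamma-1)(\rho e-\frac12\rho v^2)$, where $\gamma$ is the constant ratio of specific heats. Semi-discretization: $D$ is the derivative matrix of a periodic summation-by-parts (SBP) operator, i.e. $D$ approximates the first derivative, $Du\approx\partial_x u$, and there is a symmetric mass matrix $M$ approximating the $L^2$ scalar product, $u^TMv\approx\int uv$, such that $MD+D^TM=0$. The derivative operator is consistent, so $\sum_l D_{i,l}=0$ for every $i$. The numerical flux $f^{\mathrm{num}}=(f^{\mathrm{num}}_{\rho},f^{\mathrm{num}}_{\rho v},f^{\mathrm{num}}_{\rho e})$ is a symmetric two-point flux for the Euler equations, and $u_i$ is the numerical solution at node $i$. PEP: $f^{\mathrm{num}}$ is pressure-equilibrium-preserving if $$f^{\mathrm{num}}_{\rho v}=v f^{\mathrm{num}}_\rho+\mathrm{const}(p,v),\qquad f^{\mathrm{num}}_{\rho e}=\tfrac12v^2f^{\mathrm{num}}_\rho+\mathrm{const}(p,v),$$ whenever the velocity $v$ and the pressure $p$ are constant throughout the domain; each $\mathrm{const}(p,v)$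 denotes a (possibly different) quantity depending only on $p$ and $v$. Pressure equilibrium: a numerical solution whose velocity and pressure are constant throughout the domain (the density may vary), i.e. $(\rho v)_i=\rho_i v$ and $(\rho e)_i=\frac12\rho_i v^2+\frac{p}{\gamma-1}$ at all nodes $i$ with the same values $p$, $v$. It is preserved if the numerical solution keeps these constant values of $p$ and $v$. General linear methods are the usual class of time integration methods for ODEs $u'=g(u)$ that form stages and new values from linear combinations of previous numerical solutions and of evaluations of $g$ multiplied by the time step; this class includes Runge-Kutta and linear multistep methods. Here $g(u)_i=-\sum_l 2D_{i,l}f^{\mathrm{num}}(u_i,u_l)$.
   Formalization: Methods are taken preconsistent, with positive density and pressure at all stages. For implicit methods, every solution is an equilibrium if the stage map is contractive; otherwise an equilibrium solution exists when the mass equation with p, v frozen is solvable (spurious solutions can exist). *)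

(* Defs.v *)
From HB Require Import structures.
From mathcomp Require Import all_boot all_order all_algebra.
From mathcomp Require Import reals.

Set Implicit Arguments.
Unset Strict Implicit.
Unset Printing Implicit Defensive.

Import Order.TTheory GRing.Theory Num.Theory.
Local Open Scope ring_scope.

Section Euler.
Variable R : realType.

(* A state is the row of conserved variables (rho, rho v, rho e); the same
   triple layout is used for fluxes. *)
Definition triple (a b c : R) : 'rV[R]_3 := \row_(k < 3) [:: a; b; c]`_k.
Definition rho_c (u : 'rV[R]_3) : R := u ord0 (@Ordinal 3 0 isT).
Definition mom_c (u : 'rV[R]_3) : R := u ord0 (@Ordinal 3 1 isT).
Definition ener_c (u : 'rV[R]_3) : R := u ord0 (@Ordinal 3 2 isT).

Definition velocity (u : 'rV[R]_3) : R := mom_c u / rho_c u.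

Definition pressure (gamma : R) (u : 'rV[R]_3) : R :=
  (gamma - 1) * (ener_c u - 2^-1 * rho_c u * velocity u ^+ 2).

(* The set of states on which a numerical flux is meaningful (fluxes may
   involve, e.g., logarithmic means of density and pressure). *)
Definition admissible (gamma : R) (u : 'rV[R]_3) : Prop :=
  0 < rho_c u /\ 0 < pressure gamma u.

Definition euler_flux (gamma : R) (u : 'rV[R]_3) : 'rV[R]_3 :=
  let v := velocity u in let p := pressure gamma u in
  triple (rho_c u * v) (rho_c u * v ^+ 2 + p) ((ener_c u + p) * v).

Definition symmetric_two_point_flux (gamma : R)
    (fnum : 'rV[R]_3 -> 'rV[R]_3 -> 'rV[R]_3) : Prop :=
  (forall u w, admissible gamma u -> admissible gamma w -> fnum u w = fnum w u)
  /\ (forall u, admissible gamma u -> fnum u u = euler_flux gamma u).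

Definition pep (gamma : R) (fnum : 'rV[R]_3 -> 'rV[R]_3 -> 'rV[R]_3) : Prop :=
  exists cmom cener : R -> R -> R,
  forall (p v : R) (u w : 'rV[R]_3),
    admissible gamma u -> admissible gamma w ->
    velocity u = v -> velocity w = v ->
    pressure gamma u = p -> pressure gamma w = p ->
    mom_c (fnum u w) = v * rho_c (fnum u w) + cmom p v
    /\ ener_c (fnum u w) = 2^-1 * v ^+ 2 * rho_c (fnum u w) + cener p v.

Definition periodic_sbp (N : nat) (D M : 'M[R]_N) : Prop :=
  [/\ M^T = M,
      forall x : 'cV[R]_N, x != 0 -> 0 < (x^T *m M *m x) ord0 ord0,
      M *m D + D^T *m M = 0
    & forall i, \sum_l D i l = 0].

(* A grid function has one row per node. *)
Definition semidiscretization (N : nat) (D : 'M[R]_N)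
    (fnum : 'rV[R]_3 -> 'rV[R]_3 -> 'rV[R]_3) (u : 'M[R]_(N, 3)) : 'M[R]_(N, 3) :=
  \matrix_(i < N) (- \sum_l (2 * D i l) *: fnum (row i u) (row l u)).

Definition admissible_grid (gamma : R) (N : nat) (u : 'M[R]_(N, 3)) : Prop :=
  forall i, admissible gamma (row i u).

Definition pressure_equilibrium (gamma p v : R) (N : nat) (u : 'M[R]_(N, 3)) : Prop :=
  forall i, mom_c (row i u) = rho_c (row i u) * v
    /\ ener_c (row i u) = 2^-1 * rho_c (row i u) * v ^+ 2 + p / (gamma - 1).

Definition density (N : nat) (u : 'M[R]_(N, 3)) : 'cV[R]_N :=
  \col_i rho_c (row i u).

(* The pressure equilibrium with given nodal densities. *)
Definition equilibrium_of (gamma p v : R) (N : nat) (r : 'cV[R]_N) : 'M[R]_(N, 3) :=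
  \matrix_(i < N) triple (r i ord0) (r i ord0 * v)
                    (2^-1 * r i ord0 * v ^+ 2 + p / (gamma - 1)).

(* The mass equation of the semi-discretization, closed by imposing the
   constant values p and v. *)
Definition density_rhs (gamma p v : R) (N : nat) (D : 'M[R]_N)
    (fnum : 'rV[R]_3 -> 'rV[R]_3 -> 'rV[R]_3) (r : 'cV[R]_N) : 'cV[R]_N :=
  density (semidiscretization D fnum (equilibrium_of gamma p v r)).

End Euler.

(* General linear methods in Butcher's form: with external values y_1..y_r,
     Y_i  = h sum_j A_ij g(Y_j) + sum_j U_ij y_j     (s internal stages),
     y_i' = h sum_j B_ij g(Y_j) + sum_j V_ij y_j.
   A is an arbitrary matrix, so implicit methods are included. *)
Record glm (R : realType) (s r : nat) := GLM {
  glmA : 'M[R]_s;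
  glmU : 'M[R]_(s, r);
  glmB : 'M[R]_(r, s);
  glmV : 'M[R]_r
}.

Section GeneralLinearMethods.
Variables (R : realType) (s r : nat) (meth : glm R s r).

(* The preconsistency vector q: the j-th external value represents
   q_j u(t_n) up to terms of order h.  U q = 1 and V q = q say that the method
   is exact for u' = 0. *)
Definition preconsistent (q : 'cV[R]_r) : Prop :=
  glmU meth *m q = const_mx 1 /\ glmV meth *m q = q.

Definition explicit : Prop :=
  forall i j : 'I_s, (i <= j)%N -> glmA meth i j = 0.

Variable V : lmodType R.

Definition stage_start (y : 'I_r -> V) (i : 'I_s) : V :=
  \sum_j glmU meth i j *: y j.

Definition stage_map (g : V -> V) (h : R) (y : 'I_r -> V) (Y : 'I_s -> V)
    (i : 'I_s) : V :=
  h *: (\sum_j glmA meth i j *: g (Y j)) + stage_start y i.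

Definition update (g : V -> V) (h : R) (y : 'I_r -> V) (Y : 'I_s -> V)
    (i : 'I_r) : V :=
  h *: (\sum_j glmB meth i j *: g (Y j)) + \sum_j glmV meth i j *: y j.

(* The first T steps.  y n j: external values entering step n; Y n i: stages of
   step n; h n: size of step n. *)
Definition glm_solution (g : V -> V) (h : nat -> R) (T : nat)
    (y : nat -> 'I_r -> V) (Y : nat -> 'I_s -> V) : Prop :=
  forall n, (n < T)%N ->
    (forall i, Y n i = stage_map g (h n) (y n) (Y n) i)
    /\ (forall i, y n.+1 i = update g (h n) (y n) (Y n) i).

(* The numerical solution is read off the external values with weights theta;
   theta q = 1 makes it an approximation of u(t_n) itself. *)
Definition glm_output (theta : 'rV[R]_r) (y : 'I_r -> V) : V :=
  \sum_j theta ord0 j *: y j.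

(* Starting values formed from states satisfying P and evaluations of g at
   them.  The coefficients S absorb the factor h. *)
Definition starting_values (g : V -> V) (P : V -> Prop) (q : 'cV[R]_r)
    (y0 : 'I_r -> V) : Prop :=
  exists (k : nat) (W S : 'M[R]_(r, k)) (u : 'I_k -> V),
    [/\ forall m, P (u m),
        forall j, \sum_m W j m = q j ord0
      & forall j, y0 j = \sum_m W j m *: u m + \sum_m S j m *: g (u m)].

End GeneralLinearMethods.

(* The usual solvability condition for implicit stage equations: on a set S of
   stage values in the domain dom, containing the starting guess (stages at
   h = 0) and the stages Y, the stage map is a contraction in a weighted
   maximum norm.  Without such a condition implicit stage equations can have
   spurious solutions unrelated to the data, for which no invariance of the
   numerical solution can be expected. *)
Definition contractive_stages (R : realType) (s r m k : nat) (meth : glm R s r)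
    (dom : 'M[R]_(m, k) -> Prop) (g : 'M[R]_(m, k) -> 'M[R]_(m, k)) (h : R)
    (y : 'I_r -> 'M[R]_(m, k)) (Y : 'I_s -> 'M[R]_(m, k)) : Prop :=
  exists (S : ('I_s -> 'M[R]_(m, k)) -> Prop) (w : 'I_s -> 'M[R]_(m, k)) (c : R),
    [/\ [/\ 0 <= c, c < 1 & forall i a b, 0 < w i a b],
        S (stage_start meth y) /\ S Y,
        forall Z, S Z -> forall i, dom (Z i),
        forall Z, S Z -> S (stage_map meth g h y Z)
      & forall Z Z' (e : R), S Z -> S Z' ->
          (forall i a b, `|Z i a b - Z' i a b| <= e * w i a b) ->
          forall i a b, `|stage_map meth g h y Z i a b
                          - stage_map meth g h y Z' i a b| <= c * e * w i a b].

(* Main.v *)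
Require Import Defs.
From mathcomp Require Import all_boot all_order all_algebra.
From mathcomp Require Import reals.
From mathcomp Require pseudometric_normed_Zmodule normed_module sequences.
Import Order.TTheory GRing.Theory Num.Theory.
Import normed_module.numFieldNormedType.Exports.
Set Implicit Arguments.
Unset Strict Implicit.

Local Open Scope ring_scope.

(** Being in the pressure equilibrium with fixed [p] and [v] is an affine
    condition on the conserved variables: with
      [d = (1, v, v^2 / 2)]  and  [b = (0, 0, p / (gamma - 1))],
    the equilibria are the states [x *: d + b], the density [x] being free.
    The linear map [L u = u - density u *m d] forgets exactly the component
    along [d], so a grid function is in equilibrium iff [L u = F], where every
    row of [F] is [b].

    The flux condition says that on two equilibrium states the numerical flux
    is a multiple of [d] plus a constant; hence [L] of the flux is the same
    constant for all pairs of nodes, and [\sum_l D i l = 0] annihilates it.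
    Thus [L (g u) = 0] at every admissible equilibrium [u]
    ([semidiscretization_defect0]): the right-hand side is tangent to the
    fiber [L = F].

    A general linear method then stays on the fiber, since it only forms linear
    combinations.  The external value [y_j] represents [q_j u], so the invariant
    is [L (y_j) = q_j F].  Preconsistency [U q = 1] puts the stages on [L = F],
    [V q = q] reproduces the invariant after the step, and [theta q = 1] puts
    the output on [L = F].

    This reasoning presupposes that the stages are already on the fiber when
    [g] is evaluated.  For explicit methods that is an induction over the stages
    ([explicit_stages_on_fiber]).  For implicit ones with a contractive stage
    map, the fixed-point iteration from the stages at [h = 0] remains on the
    fiber and converges to the stages of the method, and the fiber is closed
    ([contractive_stages_on_fiber]).

    Conversely, equilibrium solutions can be built from solutions of the mass
    equation alone: the maps [x |-> x *m d + c F] are right inverses of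
    [density] that carry the frozen mass equation to the full system, so the
    lifted values and stages solve the equations of the method
    ([glm_solution_lift]). *)

(** * General linear methods and linear invariants *)

Section LinearInvariants.
Variables (R : realType) (s r : nat) (meth : glm R s r) (q : 'cV[R]_r).
Hypothesis q_preconsistent : preconsistent meth q.
Variables (V W : lmodType R) (L : {linear V -> W}) (F : W).

Lemma linear_comb_on_fiber n (a b : 'I_n -> R) (x : 'I_n -> V) :
  (forall j, L (x j) = b j *: F) ->
  L (\sum_j a j *: x j) = (\sum_j a j * b j) *: F.
Proof.
move=> Lx; rewrite linear_sum scaler_suml; apply: eq_bigr => j _.
by rewrite linearZ /= Lx scalerA.
Qed.

(** Vanishing is only asked where the coefficient is nonzero: for an explicit
    method nothing is known yet about the later stages, whose coefficients are
    zero. *)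
Lemma linear_comb_in_ker n (a : 'I_n -> R) (x : 'I_n -> V) :
  (forall j, a j != 0 -> L (x j) = 0) -> L (\sum_j a j *: x j) = 0.
Proof.
move=> Lx; rewrite linear_sum big1 // => j _; rewrite linearZ /=.
by have [->|/Lx ->] := eqVneq (a j) 0; rewrite ?scale0r ?scaler0.
Qed.

(** The [j]-th external value approximates [q_j] times the solution (plus terms
    of order [h]); the weight [q_j] is therefore the right multiple of [F]. *)
Definition external_on_fiber (y : 'I_r -> V) : Prop :=
  forall j, L (y j) = q j ord0 *: F.

Lemma stage_start_on_fiber (y : 'I_r -> V) (i : 'I_s) :
  external_on_fiber y -> L (stage_start meth y i) = F.
Proof.
move=> Ly; rewrite (linear_comb_on_fiber _ Ly).
have /matrixP/(_ i ord0) := q_preconsistent.1.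
by rewrite !mxE => ->; rewrite scale1r.
Qed.

Lemma stage_map_on_fiber (g : V -> V) h y (Y : 'I_s -> V) (i : 'I_s) :
  external_on_fiber y ->
  (forall j, glmA meth i j != 0 -> L (g (Y j)) = 0) ->
  L (stage_map meth g h y Y i) = F.
Proof.
move=> Ly LgY; rewrite linearD linearZ /= linear_comb_in_ker //.
by rewrite scaler0 add0r stage_start_on_fiber.
Qed.

Lemma update_on_fiber (g : V -> V) h y (Y : 'I_s -> V) :
  external_on_fiber y -> (forall j, L (g (Y j)) = 0) ->
  external_on_fiber (update meth g h y Y).
Proof.
move=> Ly LgY i; rewrite linearD linearZ /= linear_comb_in_ker // scaler0 add0r.
rewrite (linear_comb_on_fiber _ Ly).
by have /matrixP/(_ i ord0) := q_preconsistent.2; rewrite mxE => ->.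
Qed.

Lemma glm_output_on_fiber (theta : 'rV[R]_r) (y : 'I_r -> V) :
  theta *m q = 1 -> external_on_fiber y -> L (glm_output theta y) = F.
Proof.
move=> thetaq Ly; rewrite (linear_comb_on_fiber _ Ly).
have /matrixP/(_ ord0 ord0) := thetaq.
by rewrite !mxE => ->; rewrite scale1r.
Qed.

Variables (g : V -> V) (dom : V -> Prop).
Hypothesis tangent : forall u, dom u -> L u = F -> L (g u) = 0.

(** Starting procedures add increments [g (u m)], which [L] annihilates, to
    combinations of states whose coefficients sum to [q_j]. *)
Lemma starting_values_on_fiber (P : V -> Prop) (y0 : 'I_r -> V) :
  (forall u, P u -> dom u /\ L u = F) ->
  starting_values g P q y0 -> external_on_fiber y0.
Proof.
move=> PdomF [k [Wt [S [u [Pu sumW y0E]]]]] j.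
have Lu m : L (u m) = 1 *: F by rewrite scale1r; have [] := PdomF _ (Pu m).
rewrite y0E linearD (linear_comb_on_fiber _ Lu) linear_comb_in_ker.
  rewrite addr0 -sumW; congr (_ *: _).
  by apply: eq_bigr => m _; rewrite mulr1.
by move=> m _; have [] := PdomF _ (Pu m); apply: tangent.
Qed.

Lemma explicit_stages_on_fiber h y (Y : 'I_s -> V) :
  explicit meth -> external_on_fiber y ->
  (forall i, dom (Y i)) -> (forall i, Y i = stage_map meth g h y Y i) ->
  forall i, L (Y i) = F.
Proof.
move=> expl Ly domY YE i.
have [m] := ubnP i; elim: m => // m IHm in i * => /ltnSE le_im.
rewrite YE; apply: stage_map_on_fiber => // j Aij.
apply: tangent => //; apply: IHm; rewrite (leq_trans _ le_im) //.
by rewrite ltnNge; apply: contra Aij => le_ij; rewrite expl.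
Qed.

Lemma glm_solution_on_fiber (h : nat -> R) (T : nat)
    (y : nat -> 'I_r -> V) (Y : nat -> 'I_s -> V) :
  glm_solution meth g h T y Y -> external_on_fiber (y 0%N) ->
  (forall n i, (n < T)%N -> dom (Y n i)) ->
  (forall n, (n < T)%N -> external_on_fiber (y n) -> forall i, L (Y n i) = F) ->
  forall n, (n <= T)%N -> external_on_fiber (y n).
Proof.
move=> sol Ly0 domY LY; elim=> // n IHn lt_nT j.
have Lyn := IHn (ltnW lt_nT).
rewrite (sol n lt_nT).2; apply: update_on_fiber => // i.
by apply: tangent; [exact: domY | exact: LY].
Qed.

End LinearInvariants.

(** * Stages as limits of fixed-point iterations *)

Lemma nonpos_geometric_bound (R : realType) (c K x : R) :
  0 <= c -> c < 1 -> (forall k, x <= K * c ^+ k) -> x <= 0.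
Proof.
move=> c_ge0 c_lt1 xle; rewrite leNgt; apply/negP => x_gt0.
have normc_lt1 : `|c| < 1 by rewrite ger0_norm.
have [k _ /(_ k (leqnn k)) /=] :=
  pseudometric_normed_Zmodule.cvgr0_norm_lt _
    (sequences.cvg_geometric K normc_lt1) _ x_gt0.
by rewrite ltNge (le_trans (xle k)) // ler_norm.
Qed.

Lemma weighted_norm_bounded (R : realType) (s m k : nat)
    (w Z : 'I_s -> 'M[R]_(m, k)) :
  (forall i a b, 0 < w i a b) ->
  exists e, forall i a b, `|Z i a b| <= e * w i a b.
Proof.
move=> w_gt0; exists (\sum_i \sum_a \sum_b `|Z i a b| / w i a b) => i a b.
have q_ge0 i' a' b' : 0 <= `|Z i' a' b'| / w i' a' b'.
  by rewrite divr_ge0 // ltW.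
rewrite -ler_pdivrMr // (bigD1 i) //= (bigD1 a) //= (bigD1 b) //=.
rewrite -!addrA lerDl !addr_ge0 // ?sumr_ge0 // => i' _.
  by rewrite sumr_ge0.
by rewrite sumr_ge0 // => a' _; rewrite sumr_ge0.
Qed.

(** The iterates [Z n] of the stage map lie on the fiber, and their distance to
    [Y] decays like [c ^ n] in the weighted norm.  Since [L] is given by a
    matrix, [L (Y i) - F = L (Y i - Z n i)] is entrywise bounded by a multiple
    of [c ^ n] for every [n], hence zero. *)
Lemma contractive_stages_on_fiber (R : realType) (s r m k l : nat)
    (meth : glm R s r) (q : 'cV[R]_r) (E : 'M[R]_(k, l)) (F : 'M[R]_(m, l))
    (dom : 'M[R]_(m, k) -> Prop) (g : 'M[R]_(m, k) -> 'M[R]_(m, k)) (h : R)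
    (y : 'I_r -> 'M[R]_(m, k)) (Y : 'I_s -> 'M[R]_(m, k)) :
  preconsistent meth q ->
  (forall u, dom u -> u *m E = F -> g u *m E = 0) ->
  external_on_fiber q (mulmxr E : {linear _ -> _}) F y ->
  contractive_stages meth dom g h y Y ->
  (forall i, Y i = stage_map meth g h y Y i) ->
  forall i, Y i *m E = F.
Proof.
move=> hq tangent Ly [S [w [c [[c_ge0 c_lt1 w_gt0] [S0 SY] Sdom Smap contr]]]] YE.
pose Z n := iter n (stage_map meth g h y) (stage_start meth y).
have SZ n : S (Z n) by elim: n => // n IHn; exact: Smap.
have ZF n i : Z n i *m E = F.
  elim: n i => [|n IHn] i.
    exact: (stage_start_on_fiber hq (L := mulmxr E : {linear _ -> _})).
  apply: (stage_map_on_fiber hq (L := mulmxr E : {linear _ -> _})) => //.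
  by move=> j _; apply: tangent; [exact: Sdom | exact: IHn].
have [e dist0] := weighted_norm_bounded (fun i => Z 0%N i - Y i) w_gt0.
have distZ n i a b : `|Z n i a b - Y i a b| <= e * c ^+ n * w i a b.
  elim: n i a b => [|n IHn] i a b.
    by have := dist0 i a b; rewrite !mxE expr0 mulr1.
  rewrite YE.
  have -> : e * c ^+ n.+1 = c * (e * c ^+ n) by rewrite exprS mulrCA.
  exact: contr.
move=> i; apply/matrixP => a b; apply/eqP; rewrite -subr_eq0 -normr_le0.
pose K := e * \sum_j w i a j * `|E j b|.
apply: (nonpos_geometric_bound (K := K) c_ge0 c_lt1) => // n.
have -> : (Y i *m E) a b - F a b = - \sum_j (Z n i a j - Y i a j) * E j b.
  rewrite -(ZF n i) !mxE -sumrB -sumrN; apply: eq_bigr => j _.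
  by rewrite mulrBl opprB.
rewrite normrN (le_trans (ler_norm_sum _ _ _)) // /K mulrAC mulr_sumr.
apply: ler_sum => j _.
by rewrite normrM mulrA ler_wpM2r.
Qed.

(** * Pressure equilibria as a fiber of a linear map *)

Section Equilibria.
Variables (R : realType) (gamma p v : R).

Notation k0 := (@Ordinal 3 0 isT).
Notation k1 := (@Ordinal 3 1 isT).
Notation k2 := (@Ordinal 3 2 isT).

Lemma state_ext (x y : 'rV[R]_3) :
  rho_c x = rho_c y -> mom_c x = mom_c y -> ener_c x = ener_c y -> x = y.
Proof.
move=> eq0 eq1 eq2; apply/rowP => -[[|[|[|k]]] lt_k3] //.
- by have -> : Ordinal lt_k3 = k0 by exact: val_inj.
- by have -> : Ordinal lt_k3 = k1 by exact: val_inj.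
- by have -> : Ordinal lt_k3 = k2 by exact: val_inj.
Qed.

(** At fixed [v] and [p], the conserved variables change along this row when the
    density changes. *)
Definition mass_direction : 'rV[R]_3 := triple 1 v (2^-1 * v ^+ 2).

Definition equilibrium_base N : 'M[R]_(N, 3) :=
  const_mx 1 *m triple 0 0 (p / (gamma - 1)).

(** Right multiplication by this matrix removes the multiple of
    [mass_direction] that carries the mass, see [mul_defect_mx].  Writing the
    map as a matrix product gives its linearity and its continuity at once. *)
Definition defect_mx : 'M[R]_3 := 1%:M - delta_mx k0 ord0 *m mass_direction.

Lemma densityE N (u : 'M[R]_(N, 3)) : density u = u *m delta_mx k0 (@ord0 0).
Proof.
apply/colP => i; rewrite !mxE /rho_c mxE (bigD1 k0) //= !mxE /= mulr1 big1 ?addr0 //.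
by move=> k /negPf k0F; rewrite !mxE k0F mulr0.
Qed.

Lemma mul_defect_mx N (u : 'M[R]_(N, 3)) :
  u *m defect_mx = u - density u *m mass_direction.
Proof. by rewrite mulmxBr mulmx1 mulmxA densityE. Qed.

(** The unique [u] with density [x] on the fiber [u *m defect_mx = c *: base].
    Weights [c] other than 1 occur for external values ([c = q_j]) and for time
    derivatives ([c = 0]). *)
Definition equilibrium_lift N (c : R) (x : 'cV[R]_N) : 'M[R]_(N, 3) :=
  x *m mass_direction + c *: equilibrium_base N.

Lemma row_equilibrium_lift N c (x : 'cV[R]_N) i :
  row i (equilibrium_lift c x) =
  triple (x i ord0) (x i ord0 * v)
         (2^-1 * x i ord0 * v ^+ 2 + c * (p / (gamma - 1))).
Proof.
apply: state_ext; rewrite /rho_c /mom_c /ener_c !mxE !big_ord1 !mxE /=.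
- by rewrite !mulr0 mulr1 addr0.
- by rewrite !mulr0 addr0.
- by rewrite mul1r mulrCA mulrA.
Qed.

Lemma density_equilibrium_lift N c (x : 'cV[R]_N) :
  density (equilibrium_lift c x) = x.
Proof. by apply/colP => i; rewrite mxE row_equilibrium_lift /rho_c mxE. Qed.

Lemma defect_fiberP N c (u : 'M[R]_(N, 3)) :
  u *m defect_mx = c *: equilibrium_base N <->
  u = equilibrium_lift c (density u).
Proof.
rewrite mul_defect_mx /equilibrium_lift; split=> [<-|{1}->]; first by rewrite addrC subrK.
by rewrite addrAC subrr add0r.
Qed.

Lemma equilibrium_ofE N (x : 'cV[R]_N) :
  equilibrium_of gamma p v x = equilibrium_lift 1 x.
Proof. by apply/row_matrixP => i; rewrite rowK row_equilibrium_lift mul1r. Qed.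

Lemma pressure_equilibriumP N (u : 'M[R]_(N, 3)) :
  pressure_equilibrium gamma p v u <-> u *m defect_mx = equilibrium_base N.
Proof.
rewrite -[equilibrium_base N]scale1r; split=> [eq_u|/defect_fiberP -> i].
  apply/defect_fiberP/row_matrixP => i.
  rewrite row_equilibrium_lift mul1r [density u i _]mxE.
  have [momE enerE] := eq_u i.
  by apply: state_ext; rewrite ?momE ?enerE /rho_c /mom_c /ener_c !mxE.
by rewrite row_equilibrium_lift mul1r /mom_c /ener_c /rho_c !mxE.
Qed.

Lemma sum_equilibrium_lift N n (a c : 'I_n -> R) (x : 'I_n -> 'cV[R]_N) :
  \sum_j a j *: equilibrium_lift (c j) (x j) =
  equilibrium_lift (\sum_j a j * c j) (\sum_j a j *: x j).
Proof.
rewrite /equilibrium_lift mulmx_suml scaler_suml -big_split.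
by apply: eq_bigr => j _; rewrite scalerDr scalerA -scalemxAl.
Qed.

Lemma equilibrium_liftD N c d (x y : 'cV[R]_N) :
  equilibrium_lift c x + equilibrium_lift d y = equilibrium_lift (c + d) (x + y).
Proof. by rewrite /equilibrium_lift addrACA -mulmxDl -scalerDl. Qed.

Lemma scale_equilibrium_lift N a c (x : 'cV[R]_N) :
  a *: equilibrium_lift c x = equilibrium_lift (a * c) (a *: x).
Proof. by rewrite /equilibrium_lift scalerDr scalerA -scalemxAl. Qed.

(** * The semi-discretization is tangent to the fiber *)

Hypothesis gamma_gt1 : 1 < gamma.

Lemma velocity_triple (x : R) e : x != 0 -> velocity (triple x (x * v) e) = v.
Proof. by move=> x_neq0; rewrite /velocity /mom_c /rho_c !mxE /= mulrC mulKf. Qed.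

Lemma pressure_triple (x : R) : x != 0 ->
  pressure gamma (triple x (x * v) (2^-1 * x * v ^+ 2 + p / (gamma - 1))) = p.
Proof.
move=> x_neq0; rewrite /pressure velocity_triple // /ener_c /rho_c !mxE /=.
by rewrite addrAC subrr add0r mulrC divfK // subr_eq0 gt_eqF.
Qed.

Lemma equilibrium_of_admissible N (x : 'cV[R]_N) :
  0 < p -> (forall i, 0 < x i ord0) ->
  admissible_grid gamma (equilibrium_of gamma p v x).
Proof.
move=> p_gt0 x_gt0 i; rewrite rowK /admissible pressure_triple ?gt_eqF //.
by split=> //; rewrite /rho_c mxE; exact: x_gt0.
Qed.

Variable fnum : 'rV[R]_3 -> 'rV[R]_3 -> 'rV[R]_3.
Hypothesis fnum_pep : pep gamma fnum.

(** The momentum and energy fluxes differ from those of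
    [f_rho *: mass_direction] only by the constants depending on [p] and [v]. *)
Lemma pep_flux_defect_const : exists K : 'rV[R]_3, forall u w : 'rV[R]_3,
  admissible gamma u -> admissible gamma w ->
  velocity u = v -> velocity w = v ->
  pressure gamma u = p -> pressure gamma w = p ->
  fnum u w *m defect_mx = K.
Proof.
have [cmom [cener fnumE]] := fnum_pep.
exists (triple 0 (cmom p v) (cener p v)) => u w admu admw vu vw pu pw.
have [momE enerE] := fnumE _ _ _ _ admu admw vu vw pu pw.
rewrite mul_defect_mx; rewrite /rho_c /mom_c /ener_c in momE enerE.
apply: state_ext; rewrite /rho_c /mom_c /ener_c !mxE big_ord1 !mxE /rho_c mxE /=.
- by rewrite mulr1 subrr.
- by rewrite momE mulrC addrAC subrr add0r.
- by rewrite enerE mulrC addrAC subrr add0r.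
Qed.

(** After multiplication by [defect_mx] the flux no longer depends on the nodes,
    and consistency of the derivative operator applies. *)
Lemma semidiscretization_defect0 N (D : 'M[R]_N) (u : 'M[R]_(N, 3)) :
  (forall i, \sum_l D i l = 0) -> admissible_grid gamma u ->
  u *m defect_mx = equilibrium_base N ->
  semidiscretization D fnum u *m defect_mx = 0.
Proof.
move=> sumD adm_u; rewrite -[equilibrium_base N]scale1r => /defect_fiberP uE.
have [K fluxK] := pep_flux_defect_const.
have vel_p i : velocity (row i u) = v /\ pressure gamma (row i u) = p.
  have : rho_c (row i u) != 0 by rewrite gt_eqF //; have [] := adm_u i.
  rewrite uE row_equilibrium_lift mul1r {1}/rho_c mxE => rho_neq0.
  by rewrite velocity_triple ?pressure_triple.
apply/row_matrixP => i; rewrite row_mul rowK row0 mulNmx mulmx_suml.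
rewrite (eq_bigr (fun l => D i l *: (2 *: K))) => [|l _].
  by rewrite -scaler_suml sumD scale0r oppr0.
rewrite -scalemxAl mulrC scalerA fluxK //; [exact: (vel_p i).1 | | |].
- exact: (vel_p l).1.
- exact: (vel_p i).2.
- exact: (vel_p l).2.
Qed.

Lemma semidiscretization_lift N (D : 'M[R]_N) (x : 'cV[R]_N) :
  (forall i, \sum_l D i l = 0) -> 0 < p -> (forall i, 0 < x i ord0) ->
  semidiscretization D fnum (equilibrium_lift 1 x) =
  equilibrium_lift 0 (density_rhs gamma p v D fnum x).
Proof.
move=> sumD p_gt0 x_gt0; rewrite /density_rhs equilibrium_ofE.
apply/defect_fiberP; rewrite scale0r; apply: semidiscretization_defect0 => //.
  by rewrite -equilibrium_ofE; apply: equilibrium_of_admissible.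
rewrite -[RHS]scale1r; apply/defect_fiberP.
by rewrite density_equilibrium_lift.
Qed.

(** [equilibrium_lift] is jointly linear in the weight and the density, and
    [g] sends weight 1 to weight 0.  A step therefore transports densities by
    the mass equation and weights by [U] or [V], for which preconsistency gives
    the weights 1 of the stages and [q_j] of the new external values. *)
Lemma glm_solution_lift s r (meth : glm R s r) (q : 'cV[R]_r) N (D : 'M[R]_N)
    (h : nat -> R) T (rho : nat -> 'I_r -> 'cV[R]_N)
    (Rho : nat -> 'I_s -> 'cV[R]_N) :
  preconsistent meth q -> (forall i, \sum_l D i l = 0) -> 0 < p ->
  (forall n i a, (n < T)%N -> 0 < Rho n i a ord0) ->
  glm_solution meth (density_rhs gamma p v D fnum) h T rho Rho ->
  glm_solution meth (semidiscretization D fnum) h T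
    (fun n j => equilibrium_lift (q j ord0) (rho n j))
    (fun n i => equilibrium_lift 1 (Rho n i)).
Proof.
move=> [Uq Vq] sumD p_gt0 Rho_gt0 sol n lt_nT.
have [RhoE rhoE] := sol n lt_nT.
(* Stages and update have the same shape, with coefficient matrices
     (A, U) and (B, V) respectively. *)
  have stepE m (A : 'M[R]_(m, s)) (B : 'M[R]_(m, r)) i :
    h n *: (\sum_j A i j *:
             semidiscretization D fnum (equilibrium_lift 1 (Rho n j)))
      + \sum_j B i j *: equilibrium_lift (q j ord0) (rho n j) =
    equilibrium_lift ((B *m q) i ord0)
      (h n *: (\sum_j A i j *: density_rhs gamma p v D fnum (Rho n j))
        + \sum_j B i j *: rho n j).
  rewrite (eq_bigr (fun j => A i j *:
    equilibrium_lift 0 (density_rhs gamma p v D fnum (Rho n j)))) => [|j _].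
    rewrite !sum_equilibrium_lift scale_equilibrium_lift equilibrium_liftD mxE.
    by rewrite -mulr_suml mulr0 mulr0 add0r.
  by rewrite semidiscretization_lift // => a; apply: Rho_gt0.
split=> i; rewrite /stage_map /update /stage_start stepE ?Uq ?Vq.
  by rewrite mxE {1}RhoE.
by rewrite rhoE.
Qed.

End Equilibria.

Unset Implicit Arguments.

Theorem lemmaA1 (R : realType) (gamma : R) (hgamma : 1 < gamma)
    (N : nat) (D M : 'M[R]_N) (hD : periodic_sbp D M)
    (fnum : 'rV[R]_3 -> 'rV[R]_3 -> 'rV[R]_3)
    (hflux : symmetric_two_point_flux gamma fnum)
    (hpep : pep gamma fnum)
    (s r : nat) (meth : glm R s r) (q : 'cV[R]_r) (hq : preconsistent meth q)
    (theta : 'rV[R]_r) (htheta : theta *m q = 1)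
    (h : nat -> R) (hh : forall n, 0 < h n) (T : nat)
    (p v : R) (hp : 0 < p)
    (y0 : 'I_r -> 'M[R]_(N, 3))
    (hy0 : starting_values (semidiscretization D fnum)
             (fun u => admissible_grid gamma u /\ pressure_equilibrium gamma p v u)
             q y0) :
  (* Every numerical solution stays in the pressure equilibrium. *)
  (forall (y : nat -> 'I_r -> 'M[R]_(N, 3)) (Y : nat -> 'I_s -> 'M[R]_(N, 3)),
     glm_solution meth (semidiscretization D fnum) h T y Y ->
     (forall j, y 0%N j = y0 j) ->
     (forall n i, (n < T)%N -> admissible_grid gamma (Y n i)) ->
     (forall n, (n < T)%N -> explicit meth
        \/ contractive_stages meth (@admissible_grid R gamma N)
             (semidiscretization D fnum) (h n) (y n) (Y n)) ->
     (forall n i, (n < T)%N -> pressure_equilibrium gamma p v (Y n i))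
     /\ (forall n, (n <= T)%N -> pressure_equilibrium gamma p v (glm_output theta (y n))))
  /\
  (* For arbitrary implicit methods and step sizes: if the method can be applied
     to the mass equation with p and v frozen, then the resulting densities are
     those of a numerical solution of the full system that stays in the
     pressure equilibrium. *)
  (forall (rho : nat -> 'I_r -> 'cV[R]_N) (Rho : nat -> 'I_s -> 'cV[R]_N),
     glm_solution meth (density_rhs gamma p v D fnum) h T rho Rho ->
     (forall j, rho 0%N j = density (y0 j)) ->
     (forall n i a, (n < T)%N -> 0 < Rho n i a ord0) ->
     exists (y : nat -> 'I_r -> 'M[R]_(N, 3)) (Y : nat -> 'I_s -> 'M[R]_(N, 3)),
       [/\ glm_solution meth (semidiscretization D fnum) h T y Y,
           forall j, y 0%N j = y0 j,
           forall n j, (n <= T)%N -> density (y n j) = rho n j,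
           forall n i, (n < T)%N -> density (Y n i) = Rho n i
         & (forall n i, (n < T)%N -> pressure_equilibrium gamma p v (Y n i))
           /\ (forall n, (n <= T)%N ->
                 pressure_equilibrium gamma p v (glm_output theta (y n)))]).
Proof.
have [_ _ _ sumD] := hD.
pose L : {linear 'M[R]_(N, 3) -> 'M[R]_(N, 3)} := mulmxr (defect_mx v).
pose F := equilibrium_base gamma p N.
have tangent (u : 'M[R]_(N, 3)) : admissible_grid gamma u -> L u = F ->
    L (semidiscretization D fnum u) = 0.
  exact: semidiscretization_defect0.
have Ly0 : external_on_fiber q L F y0.
  apply: starting_values_on_fiber hy0; first exact: tangent.
  by move=> u [adm_u /pressure_equilibriumP].
have outputP y : external_on_fiber q L F y ->
    pressure_equilibrium gamma p v (glm_output theta y).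
  move=> Ly; apply/pressure_equilibriumP.
  exact: (glm_output_on_fiber htheta Ly).
split=> [y Y sol y0E adm_Y solvable|rho Rho sol rho0 Rho_gt0].
  have LY n : (n < T)%N -> external_on_fiber q L F (y n) ->
      forall i, L (Y n i) = F.
    move=> lt_nT Lyn; have [YE _] := sol n lt_nT.
    have [expl|contr] := solvable n lt_nT; last first.
      exact: (contractive_stages_on_fiber hq tangent Lyn contr YE).
    apply: (explicit_stages_on_fiber hq tangent expl Lyn _ YE) => i.
    exact: adm_Y.
  have Ly : forall n, (n <= T)%N -> external_on_fiber q L F (y n).
    apply: (glm_solution_on_fiber hq tangent sol) => // j.
    by rewrite y0E.
  split=> [n i lt_nT|n le_nT]; last exact/outputP/Ly.
  by apply/pressure_equilibriumP/LY => //; apply/Ly/ltnW.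
exists (fun n j => equilibrium_lift gamma p v (q j ord0) (rho n j)).
exists (fun n i => equilibrium_lift gamma p v 1 (Rho n i)).
have Llift c (x : 'cV[R]_N) : L (equilibrium_lift gamma p v c x) = c *: F.
  by apply/defect_fiberP; rewrite density_equilibrium_lift.
split=> [|j|n j _|n i _|].
- exact: glm_solution_lift.
- by rewrite rho0; apply/esym/defect_fiberP/Ly0.
- exact: density_equilibrium_lift.
- exact: density_equilibrium_lift.
split=> [n i _|n _]; last by apply: outputP => j; apply: Llift.
by apply/pressure_equilibriumP; rewrite -[RHS]scale1r; apply: Llift.
Qed.
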